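(* Let $N \ge 1$, let $C \subseteq \mathbb{R}^N_+$ be an open, convex cone and let $p \in (2,+\infty)$. Let $f : C \to (0,\infty)$ be a smooth function such that: (i) $f$ is $p$-homogeneous, i.e. $f(tx) = t^p f(x)$ for all $x \in C$ and $t>0$. (ii) For every $1 \le i \le N$, the partial derivative $\partial^i f$ is positive and log-concave on $C$ (that is, $\log(\partial^i f)$ is concave on $C$). (iii) For all distinct $i,j \in \{1,\ldots,N\}$, $\partial^{ij} f$ is non-negative on $C$; moreover, at each point of $C$ the Hessian matrix $\nabla^2 f$ is irreducible. Then the function $f^{1/p}$ is concave on $C$.
   Context: Here $\mathbb{R}^N_+ = \{x \in \mathbb{R}^N : x_i > 0 \text{ for all } i\}$. A cone (with apex at zero) is a set $C$ such that $tx \in C$ whenever $x \in C$ and $t > 0$. We write $\partial^i f = \partial f/\partial x_i$ and $\partial^{ij} f = \partial^2 f/\partial x_i \partial x_j$, and $\nabla^2 f = (\partial^{ij} f)_{i,j=1}^N$ for the Hessian matrix. The Hessian matrix is irreducible at $x \in C$ if for any two distinct indices $i,j \in \{1,\ldots,N\}$ there is a chain of indices $i, i_1, \ldots, i_L, j$ (possibly with $L=0$) such that $\partial^{i i_1} f(x) > 0$, $\partial^{i_1 i_2} f(x) > 0$, $\ldots$, $\partial^{i_L j} f(x) > 0$ (for $L = 0$ this means $\partial^{ij} f(x)>0$), with consecutive indices in the chain distinct. *)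

(* Defs.v *)
From mathcomp Require Import all_boot all_order all_algebra.
From mathcomp Require Import all_classical all_reals all_analysis.

Set Implicit Arguments.
Unset Strict Implicit.
Unset Printing Implicit Defensive.

Import Order.TTheory GRing.Theory Num.Theory.
Import numFieldNormedType.Exports.

Local Open Scope classical_set_scope.
Local Open Scope ring_scope.

Definition pos_orthant (R : numDomainType) (N : nat) : set 'rV[R]_N :=
  [set x | forall i : 'I_N, 0 < x ord0 i].

Definition cone (R : numDomainType) (V : lmodType R) (C : set V) : Prop :=
  forall (x : V) (t : R), C x -> 0 < t -> C (t *: x).

(* Functions on a subset C of R^N are represented by total functions on R^N;
   when C is open, the derivatives at a point of C depend only on the values
   taken on C. *)
Definition partial (R : realType) (N : nat) (i : 'I_N) (f : 'rV[R]_N -> R) :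
    'rV[R]_N -> R :=
  fun x => 'D_(delta_mx ord0 i) f x.

Definition hessian (R : realType) (N : nat) (f : 'rV[R]_N -> R)
    (x : 'rV[R]_N) : 'M[R]_N :=
  \matrix_(i, j) partial i (partial j f) x.

(* C^oo on an open set C: partial derivatives of all orders (s lists the
   directions of differentiation, s = [::] being f itself) exist and are
   continuous at every point of C. *)
Definition smooth_on (R : realType) (N : nat) (C : set 'rV[R]_N)
    (f : 'rV[R]_N -> R) : Prop :=
  forall (s : seq 'I_N) (x : 'rV[R]_N), C x ->
    {for x, continuous (foldr (@partial R N) f s)} /\
    forall i : 'I_N, derivable (foldr (@partial R N) f s) x (delta_mx ord0 i).

(* The sequence s lists the (possibly absent) intermediate indices of a chain
   from i to j. *)
Definition irreducible_mx (R : numDomainType) (N : nat) (A : 'M[R]_N) : Prop :=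
  forall i j : 'I_N, i != j ->
    exists s : seq 'I_N,
      path (fun k l : 'I_N => (k != l) && (0 < A k l)) i (rcons s j).

(* Order dual of convex_function; as there, D is not required to be convex. *)
Definition concave_function (R : numFieldType) (E : lmodType R)
    (E' := convex_lmodType E) (D : set E') (f : E' -> R^o) : Prop :=
  forall t : {i01 R},
    {in D &, forall x y : E',
      (conv t (f x) (f y) <= f (conv t x y))%R}.

(* Main.v *)
Require Import Defs.
From mathcomp Require Import all_boot all_order all_algebra.
From mathcomp Require Import all_classical all_reals all_analysis.
From mathcomp Require Import ring lra.

Import Order.TTheory GRing.Theory Num.Theory.
Import numFieldNormedType.Exports.

Local Open Scope classical_set_scope.
Local Open Scope ring_scope.

(** Let H be the Hessian of f at x.  Since f is p-homogeneous, so that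
    p f = <grad f, x> and H x = (p - 1) grad f, concavity of f^(1/p) amounts to
    <v, H v> <x, H x> <= <v, H x>^2 for all v: the form of H has at most one
    positive direction.

    The bound on the spectrum comes from the Bochner method.  Put g = grad f
    and let A = D H with D = diag (x_i / g_i); A is self-adjoint for the inner
    product with weights g_i / x_i, and A x = (p - 1) x.  Each partial
    derivative g_i is log-concave and homogeneous of degree q = p - 1, hence
    lies below an explicit q-th power of a linear form that is tangent to it
    at x ([logconcave_homogeneous_bound]).  Summing these bounds with weights
    y_i gives an upper bound for p f(y) = sum_i y_i g_i(y) with equality at
    y = x.  The second derivatives at x of the two sides are therefore
    comparable ([second_order_comparison]), which reads
      (p - 1) <v, H v> <= sum_i (x_i / g_i) (H v)_i^2,
    i.e. (p - 1) A <= A^2.  The assumption p > 2 enters as the positivity of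
    the coefficient q - 1.  Thus every positive eigenvalue of A is at least
    p - 1.

    On the other hand H has non-negative off-diagonal entries and is
    irreducible, so by a Perron-Frobenius argument the positive eigenvector x
    belongs to the largest eigenvalue p - 1 of A, and that eigenvalue is simple
    ([perron_frobenius_bform]).  Hence A has no positive eigenvalue orthogonally
    to x.  Instead of a spectral theorem, [reversed_cauchy_schwarz] uses one
    eigenvector only: a maximizer of the Rayleigh quotient on the complement
    of x.

    Some calculus is needed on the way: existence of directional derivatives
    from continuous partial derivatives ([is_derive_partials]) and symmetry of
    second derivatives ([derive_comm]). *)

(** * Directional derivatives *)

Lemma is_derive_line {R : realType} {V : normedModType R} (g : V -> R)
    (y v : V) (s d : R) :
  is_derive (y + s *: v) v g d ->
  is_derive s (1 : R) (fun t : R => g (y + t *: v)) d.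
Proof.
move=> [dg gd].
have E : (fun h : R => h^-1 *: (((fun t => g (y + t *: v)) \o shift s) (h *: 1)
           - g (y + s *: v)))
       = (fun h : R => h^-1 *: ((g \o shift (y + s *: v)) (h *: v) -
           g (y + s *: v))).
  apply/funext => h /=; congr (_ *: (g _ - _)).
  by rewrite [h *: 1]mulr1 scalerDl addrCA.
by split; rewrite /derivable /derive E.
Qed.

Lemma line_mvt {R : realType} {V : normedModType R} (g dg : V -> R)
    (y v : V) (k : R) :
  (forall s : R, 0 <= s <= 1 ->
     is_derive (y + (s * k) *: v) v g (dg (y + (s * k) *: v))) ->
  exists2 s : R, 0 <= s <= 1 & g (y + k *: v) - g y = k * dg (y + (s * k) *: v).
Proof.
move=> gd.
pose F (s : R) := g (y + (s * k) *: v).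
have Fd (s : R) : 0 <= s <= 1 ->
    is_derive s (1 : R) F (k * dg (y + (s * k) *: v)).
  move=> s01; have /is_derive_line gd' := gd s s01.
  rewrite mulrC.
  apply: (@is_derive1_comp _ (fun t => g (y + t *: v)) (fun s => s * k)) gd' _.
  by apply: is_derive_eq; rewrite scaler0 add0r [_ *: 1]mulr1.
have [] := @MVT R F (fun s => k * dg (y + (s * k) *: v)) 0 1 ltr01.
- by move=> s; rewrite in_itv/= => /andP[s0 s1]; apply: Fd; rewrite !ltW.
- apply: derivable_within_continuous => s; rewrite in_itv/= => s01.
  exact: (@ex_derive _ _ _ _ _ _ _ (Fd s s01)).
- move=> s; rewrite in_itv/= => /andP[s0 s1].
  rewrite /F mul1r mul0r scale0r addr0 subr0 mulr1 => ->.
  by exists s; rewrite ?ltW.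
Qed.

(** All intermediate points of the mean value arguments below have this form;
    the uniformity in a and b is what makes them converge to x. *)
Lemma near_parallelogram {R : realType} {V : normedModType R} (x u v : V)
    (A : set V) : nbhs x A ->
  \forall h \near (0 : R), forall a b : R, `|a| <= `|h| -> `|b| <= `|h| ->
    A (x + a *: u + b *: v).
Proof.
move=> /nbhs_normP[e /= e0 eA].
have M0 : 0 < `|u| + `|v| + 1 by rewrite ltr_wpDl// addr_ge0.
near=> h => a b ah bh; apply: eA => /=.
rewrite -addrA opprD addNKr normrN (le_lt_trans (ler_normD _ _))//.
rewrite !normrZ.
apply: (@le_lt_trans _ _ (`|h| * (`|u| + `|v| + 1))).
  rewrite mulrDr mulr1 ler_wpDr// mulrDr lerD// ler_wpM2r//.
rewrite -ltr_pdivlMr//; near: h.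
by apply: (@pseudometric_normed_Zmodule.nbhs0_lt R R^o); rewrite divr_gt0.
Unshelve. all: by end_near. Qed.

(** Directional derivatives add up as soon as one of the two is continuous:
    going along u first, the remaining increment along v is a multiple of the
    derivative at an intermediate point, which tends to x. *)
Lemma is_derive_addl {R : realType} {V : normedModType R} (g : V -> R)
    (x u v : V) (c du : R) :
  is_derive x u g du -> (\forall y \near x, derivable g y v) ->
  {for x, continuous ('D_v g)} ->
  is_derive x (u + c *: v) g (du + c * 'D_v g x).
Proof.
move=> [gu <-] gv cgv.
suff H : (fun h : R => h^-1 *: ((g \o shift x) (h *: (u + c *: v)) - g x)) @ 0^'
    --> 'D_u g x + c * 'D_v g x.
  by split; [apply/cvg_ex; eexists; exact: H|exact: cvg_lim H].
have -> : (fun h : R => h^-1 *: ((g \o shift x) (h *: (u + c *: v)) - g x)) =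
  (fun h => h^-1 *: ((g \o shift x) (h *: u) - g x)) \+
  (fun h => h^-1 *: (g (h *: (u + c *: v) + x) - g (h *: u + x))).
  by apply/funext => h /=; rewrite -scalerDr [in RHS]addrC subrKA.
apply: cvgD; first exact: gu.
apply/cvgrPdist_lt => e e0.
have c0 : 0 < `|c| + 1 by rewrite ltr_wpDl.
have /cvgrPdist_lt/(_ (e / (`|c| + 1))) := cgv.
rewrite divr_gt0// => /(_ isT) cg.
have gvc : nbhs x (fun y => derivable g y v /\
    `|'D_v g x - 'D_v g y| < e / (`|c| + 1)) by exact: filterI gv cg.
have := near_parallelogram x u (c *: v) _ gvc => nA.
near=> h.
have h0 : h != 0 by near: h; exact: nbhs_dnbhs_neq.
have nA' : forall a b : R, `|a| <= `|h| -> `|b| <= `|h| ->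
    derivable g (x + a *: u + b *: (c *: v)) v /\
    `|'D_v g x - 'D_v g (x + a *: u + b *: (c *: v))| < e / (`|c| + 1).
  near: h; exact: (@nbhs_dnbhs R).
have [|s s01] := @line_mvt R V g ('D_v g) (x + h *: u) v (h * c).
  move=> s /andP[s0 s1]; apply/derivableP.
  have [|] := nA' h (s * h) (lexx _).
    by rewrite normrM ger0_norm// ler_piMl.
  by rewrite scalerA mulrA.
move=> E.
have -> : h *: (u + c *: v) + x = x + h *: u + (h * c) *: v.
  by rewrite scalerDr scalerA addrC addrA.
rewrite [h *: u + x]addrC E [h^-1 *: _]mulrA mulKf// -mulrBr normrM.
have [|_] := nA' h (s * h) (lexx _).
  by case/andP: s01 => s0 s1; rewrite normrM ger0_norm// ler_piMl.
rewrite scalerA mulrA => /ltW; set w := `|_ - _| => lw.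
apply: (@le_lt_trans _ _ (`|c| * (e / (`|c| + 1)))); first exact: ler_wpM2l.
by rewrite mulrCA gtr_pMr// ltr_pdivrMr// mul1r ltrDl.
Unshelve. all: by end_near. Qed.

Lemma half_close_absurd {R : realType} (r q z : R) :
  `|r - z| < `|r - q| / 2 -> `|q - z| < `|r - q| / 2 -> False.
Proof.
move=> l1 l2; have := ltrD l1 l2; rewrite -splitr ltNge => /negP; apply.
have -> : r - q = (r - z) - (q - z) by ring.
exact: ler_normB.
Qed.

(** Schwarz's theorem.  The second difference of g over the parallelogram with
    sides h u and h v is symmetric in u and v; two applications of the mean
    value theorem make it h^2 times either mixed derivative at a nearby point.
*)
Lemma derive_comm {R : realType} {V : normedModType R} (g : V -> R)
    (x u v : V) :
  (\forall y \near x, [/\ derivable g y u, derivable g y v,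
     derivable ('D_u g) y v & derivable ('D_v g) y u]) ->
  {for x, continuous ('D_v ('D_u g))} -> {for x, continuous ('D_u ('D_v g))} ->
  'D_v ('D_u g) x = 'D_u ('D_v g) x.
Proof.
(* The second difference as a mixed derivative at an intermediate point. *)
suff W u' v' : (\forall y \near x, [/\ derivable g y u', derivable g y v',
     derivable ('D_u' g) y v' & derivable ('D_v' g) y u']) ->
  \forall h \near (0 : R), exists a b : R, [/\ `|a| <= `|h|, `|b| <= `|h| &
    g (x + h *: u' + h *: v') - g (x + h *: u') - (g (x + h *: v') - g x) =
    h * (h * 'D_v' ('D_u' g) (x + a *: u' + b *: v'))].
  move=> nd cvu cuv.
  have nd' : (\forall y \near x, [/\ derivable g y v, derivable g y u,
     derivable ('D_v g) y u & derivable ('D_u g) y v]).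
    by apply: filterS nd => y [].
  apply/eqP; apply: contrapT => /negP; rewrite -subr_eq0 -normr_gt0 => d0.
  set d := `|_| in d0.
  have d2 : 0 < d / 2 by rewrite divr_gt0.
  have /cvgrPdist_lt/(_ _ d2) c1 := cvu.
  have /cvgrPdist_lt/(_ _ d2) c2 := cuv.
  have n1 := near_parallelogram x u v _ c1.
  have n2 := near_parallelogram x v u _ c2.
  have W1 := @nbhs_dnbhs R 0 _ (W _ _ nd).
  have W2 := @nbhs_dnbhs R 0 _ (W _ _ nd').
  have {}n1 := @nbhs_dnbhs R 0 _ n1.
  have {}n2 := @nbhs_dnbhs R 0 _ n2.
  have FF : ProperFilter (0 : R)^' := Proper_dnbhs_numFieldType (0 : R).
  have FI := @filterI R (0 : R)^' FF.
  have /(@filter_ex R (0 : R)^' FF)[h [h0 [[W1h W2h] [n1h n2h]]]] :=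
    FI _ _ (@nbhs_dnbhs_neq R 0) (FI _ _ (FI _ _ W1 W2) (FI _ _ n1 n2)).
  have [a [b [ah bh E1]]] := W1h; have [a' [b' [ah' bh' E2]]] := W2h.
  have := E1; rewrite [x + _ + h *: v]addrAC.
  set A := g _; set B := g _; set C' := g _; set D := g _.
  have -> : A - B - (C' - D) = A - C' - (B - D) by ring.
  rewrite E2 => /(mulfI h0)/(mulfI h0) E.
  have l1 := n1h _ _ ah bh; have l2 := n2h _ _ ah' bh'.
  rewrite -E in l1; exact: half_close_absurd l1 l2.
move=> nd; have nA := near_parallelogram x u' v' _ nd.
near=> h.
have nA' : forall a b : R, `|a| <= `|h| -> `|b| <= `|h| ->
  [/\ derivable g (x + a *: u' + b *: v') u',
      derivable g (x + a *: u' + b *: v') v',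
      derivable ('D_u' g) (x + a *: u' + b *: v') v' &
      derivable ('D_v' g) (x + a *: u' + b *: v') u'].
  by near: h.
have sh (s : R) : 0 <= s <= 1 -> `|s * h| <= `|h|.
  by case/andP=> s0 s1; rewrite normrM ger0_norm// ler_piMl.
pose G y := g (y + h *: v') - g y.
have [|s s01] := @line_mvt R V G
  (fun y => 'D_u' g (y + h *: v') - 'D_u' g y) x u' h.
  move=> s s01; apply: is_deriveB.
    have [+ _ _ _] := nA' (s * h) h (sh _ s01) (lexx _).
    move=> /derivableP [dg gd].
    have E : (fun k : R => k^-1 *: (((fun t => g (t + h *: v')) \o
          shift (x + (s * h) *: u')) (k *: u')
           - g (x + (s * h) *: u' + h *: v')))
       = (fun k : R => k^-1 *: ((g \o shift (x + (s * h) *: u' + h *: v'))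
           (k *: u') - g (x + (s * h) *: u' + h *: v'))).
      by apply/funext => k /=; rewrite !addrA.
    by split; [move: dg|]; rewrite /derivable /derive E.
  apply/derivableP.
  have [|+ _ _ _] := nA' (s * h) 0 (sh _ s01); first by rewrite normr0.
  by rewrite scale0r addr0.
rewrite /G => ->.
have [|r r01 ->] := @line_mvt R V ('D_u' g) ('D_v' ('D_u' g))
    (x + (s * h) *: u') v' h.
  move=> r r01; apply/derivableP.
  have [_ _ D _] := nA' (s * h) (r * h) (sh _ s01) (sh _ r01); exact: D.
by exists (s * h), (r * h); split; rewrite ?sh.
Unshelve. all: by end_near. Qed.

(** If d2 < 0, then dF, which vanishes at the minimum 0, is negative just to the
    right of 0, and F decreases there. *)
Lemma second_derive_min {R : realType} (F dF : R -> R) (d2 : R) :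
  (\forall t \near (0 : R), F 0 <= F t) ->
  (\forall t \near (0 : R), is_derive t (1 : R) F (dF t)) ->
  is_derive (0 : R) 1 dF d2 -> 0 <= d2.
Proof.
move=> F0 Fd dFd; rewrite leNgt; apply/negP => d2lt0.
have : nbhs (0 : R) (fun t : R => F 0 <= F t /\ is_derive t (1 : R) F (dF t)).
  exact: filterI F0 Fd.
move=> /nbhs_normP[e /= e0 eA].
have {eA} eA t : `|t| < e -> F 0 <= F t /\ is_derive t (1 : R) F (dF t).
  by move=> te; apply: eA => /=; rewrite sub0r normrN.
have dF0 : dF 0 = 0.
  have e00 : 0 \in `](- e), e[ by rewrite in_itv/= e0 oppr_lt0 e0.
  have [||_ H0] := @derive1_at_min R F (- e) e 0 (ltW (gtrN e0)) _ e00.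
  - move=> t; rewrite in_itv/= -ltr_norml => te.
    by have [_ dF_t] := eA _ te; exact: (@ex_derive _ _ _ _ _ _ _ dF_t).
  - by move=> t; rewrite in_itv/= -ltr_norml => te; have [] := eA _ te.
  - by have [|_ [_ <-]] := eA 0; first by rewrite normr0.
have [dd dv] := dFd.
have : (fun h : R => h^-1 *: ((dF \o shift 0) (h *: 1) - dF 0)) @ 0^' --> d2.
  by rewrite -dv; exact: dd.
move=> /cvgrPdist_lt/(_ (- d2)); rewrite oppr_gt0 => /(_ d2lt0).
move=> /nbhs_normP[r /= r0 rA].
have dFneg t : 0 < t -> t < r -> dF t < 0.
  move=> t0 tr.
  have := rA t; rewrite /= sub0r normrN gtr0_norm// gt_eqF// dF0 subr0 addr0.
  rewrite [t *: 1]mulr1 => /(_ tr isT); rewrite ltr_norml opprK => /andP[+ _].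
  rewrite ltrBrDr gtrDl [_ *: _]mulrC.
  by rewrite pmulr_llt0 ?invr_gt0.
(* A step that is short enough for both neighbourhoods found above. *)
pose h := Num.min r e / 2.
have h0 : 0 < h by rewrite divr_gt0// lt_min r0 e0.
have hm : h < Num.min r e.
  by rewrite ltr_pdivrMr// ltr_pMr ?ltr1n// lt_min r0 e0.
have hr : h < r by rewrite (lt_le_trans hm)// ge_min lexx.
have he : h < e by rewrite (lt_le_trans hm)// ge_min lexx orbT.
have tE t : 0 <= t <= h -> is_derive t (1 : R) F (dF t).
  by case/andP=> t0 th; have [] := eA t; rewrite ?ger0_norm// (le_lt_trans th).
have [] := @MVT R F dF 0 h h0.
- by move=> t; rewrite in_itv/= => /andP[t0 th]; apply: tE; rewrite !ltW.
- apply: derivable_within_continuous => t; rewrite in_itv/= => th.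
  exact: (@ex_derive _ _ _ _ _ _ _ (tE t th)).
- move=> c; rewrite in_itv/= subr0 => /andP[c0 ch] E.
  have [|Fh _] := eA h; first by rewrite gtr0_norm.
  have : F h - F 0 < 0 by rewrite E pmulr_llt0// dFneg// (lt_trans ch).
  by rewrite subr_lt0 ltNge Fh.
Qed.

(** * Bilinear forms and the Perron-Frobenius argument *)

Definition bform {R : realType} {N : nat} (H : 'M[R]_N) (u v : 'rV[R]_N) : R :=
  \sum_i (u *m H) ord0 i * v ord0 i.

Lemma bformDl {R : realType} {N} (H : 'M[R]_N) (k : R) (u1 u2 v : 'rV[R]_N) :
  bform H (u1 + k *: u2) v = bform H u1 v + k * bform H u2 v.
Proof.
rewrite /bform mulmxDl -scalemxAl mulr_sumr -big_split/=.
by apply: eq_bigr => i _; rewrite !mxE mulrDl mulrA.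
Qed.

Lemma bform0l {R : realType} {N} (H : 'M[R]_N) (v : 'rV[R]_N) :
  bform H 0 v = 0.
Proof. by rewrite /bform mul0mx big1// => i _; rewrite mxE mul0r. Qed.

Lemma bformC {R : realType} {N} (H : 'M[R]_N) (u v : 'rV[R]_N) :
  H^T = H -> bform H u v = bform H v u.
Proof.
move=> HT; rewrite /bform.
transitivity (\sum_i \sum_j u ord0 j * H j i * v ord0 i).
  by apply: eq_bigr => i _; rewrite mxE mulr_suml.
rewrite exchange_big/=; apply: eq_bigr => i _; rewrite mxE mulr_suml.
by apply: eq_bigr => j _; rewrite -[in LHS]HT mxE; ring.
Qed.

Lemma bformDr {R : realType} {N} (H : 'M[R]_N) (k : R) (u1 u2 v : 'rV[R]_N) :
  H^T = H -> bform H v (u1 + k *: u2) = bform H v u1 + k * bform H v u2.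
Proof. by move=> HT; rewrite bformC// bformDl !(bformC _ v). Qed.

Lemma bform_diag {R : realType} {N} (w u v : 'rV[R]_N) :
  bform (diag_mx w) u v = \sum_i w ord0 i * u ord0 i * v ord0 i.
Proof.
by apply: eq_bigr => i _; rewrite mul_mx_diag mxE [u _ _ * _]mulrC.
Qed.

Lemma continuous_sum_ord {R : realType} {T : topologicalType} {N : nat}
    (F : 'I_N -> T -> R) :
  (forall i, continuous (F i)) -> continuous (fun x => \sum_i F i x).
Proof. by move=> cF; apply: continuous_big => //; exact: add_continuous. Qed.

Lemma bform_continuous {R : realType} {N} (H : 'M[R]_N) (u : 'rV[R]_N) :
  continuous (bform H u).
Proof.
apply: continuous_sum_ord => i v; apply: continuousM; first exact: cst_continuous.
exact: coord_continuous.
Qed.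

Lemma bform_sq_continuous {R : realType} {N} (H : 'M[R]_N) :
  continuous (fun v => bform H v v).
Proof.
apply: continuous_sum_ord => i v.
apply: continuousM; last exact: coord_continuous.
rewrite (_ : (fun v => _) = fun v : 'rV_N => \sum_j v ord0 j * H j i); last first.
  by apply/funext => u; rewrite mxE.
apply: continuous_sum_ord => j u; apply: continuousM; last exact: cst_continuous.
exact: coord_continuous.
Qed.

Lemma bform_diag_gt0 {R : realType} {N} (w v : 'rV[R]_N) :
  (forall i, 0 < w ord0 i) -> v != 0 -> 0 < bform (diag_mx w) v v.
Proof.
move=> w0 /rV0Pn[i vi]; rewrite bform_diag (bigD1 i)//=.
rewrite ltr_pwDl//; first by rewrite -mulrA mulr_gt0// -expr2 exprn_even_gt0.
by apply: sumr_ge0 => j _; rewrite -mulrA -expr2 mulr_ge0 ?sqr_ge0 ?ltW.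
Qed.

(** The supremum of the Rayleigh quotient of H relative to the weights w, over
    the w-orthogonal complement of a, is attained: by homogeneity it suffices
    to maximize over the intersection with the unit sphere of w, which is
    compact. *)
Lemma rayleigh_max_perp {R : realType} {N : nat} (H : 'M[R]_N) (w a : 'rV[R]_N) :
  (forall i, 0 < w ord0 i) ->
  (exists2 v : 'rV[R]_N, v != 0 & bform (diag_mx w) a v = 0) ->
  exists (M : R) (v : 'rV[R]_N), [/\ v != 0, bform (diag_mx w) a v = 0,
    bform H v v = M * bform (diag_mx w) v v &
    forall u, bform (diag_mx w) a u = 0 ->
      bform H u u <= M * bform (diag_mx w) u u].
Proof.
move=> w0 [v0 v00 av0].
set W := diag_mx w.
have scale (v : 'rV[R]_N) : v != 0 -> exists2 k : R, k ^+ 2 * bform W v v = 1 &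
    0 < k ^+ 2.
  move=> v_neq0; have Wv := bform_diag_gt0 _ _ w0 v_neq0.
  exists (Num.sqrt (bform W v v))^-1; last first.
    by rewrite exprn_gt0// invr_gt0 sqrtr_gt0.
  by rewrite exprVn sqr_sqrtr ?ltW// mulVf// gt_eqF.
have bZl (B : 'M[R]_N) k u v : bform B (k *: u) v = k * bform B u v.
  by rewrite -[k *: u]add0r bformDl bform0l add0r.
have bZr (B : 'M[R]_N) k u v : bform B v (k *: u) = k * bform B v u.
  rewrite /bform mulr_sumr; apply: eq_bigr => i _.
  by rewrite [X in _ * X]mxE mulrCA.
pose K : set 'rV[R]_N := [set v | bform W v v = 1] `&` [set v | bform W a v = 0].
have K0 : K !=set0.
  have [k k1 _] := scale v0 v00.
  by exists (k *: v0); split => /=; rewrite ?bZl bZr ?av0 ?mulr0// mulrA -expr2.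
have cK : compact K.
  apply: bounded_closed_compact; last first.
    have /continuous_closedP c1 := bform_sq_continuous W.
    have /continuous_closedP c2 := bform_continuous W a.
    apply: closedI; first exact: (c1 _ (@closed_eq R 1)).
    exact: (c2 _ (@closed_eq R 0)).
  exists (1 + \sum_i (w ord0 i)^-1); split; first exact: num_real.
  move=> r Mr v [/= Wv _].
  apply: le_trans (ltW Mr).
  have S0 : 0 <= \sum_i (w ord0 i)^-1.
    by apply: sumr_ge0 => i _; rewrite invr_ge0 ltW.
  rewrite /Num.norm/= mx_normrE; apply/bigmax_leP.
  split; first by rewrite addr_ge0.
  move=> [i0 i] _ /=; rewrite ord1 {i0}.
  have vi : v ord0 i ^+ 2 <= (w ord0 i)^-1.
    rewrite -[leRHS]mul1r ler_pdivlMr// -Wv bform_diag (bigD1 i)//=.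
    rewrite mulrC expr2 mulrA lerDl; apply: sumr_ge0 => j _.
    by rewrite -mulrA -expr2 mulr_ge0 ?sqr_ge0 ?ltW.
  have : (w ord0 i)^-1 <= \sum_i (w ord0 i)^-1.
    rewrite (bigD1 i)//= lerDl; apply: sumr_ge0 => j _.
    by rewrite invr_ge0 ltW.
  (* |v_i| <= 1 + v_i^2 avoids the square root of 1 / w_i. *)
  have := sqr_ge0 (`|v ord0 i| - 1).
  rewrite -(real_normK (num_real (v ord0 i))) in vi *.
  have := normr_ge0 (v ord0 i).
  by move: vi; move: `|v ord0 i| (w ord0 i)^-1 (\sum_i _) => y z s; nra.
have [] := @EVT_max_rV R N (fun v => bform H v v) K K0 cK.
  by apply: continuous_subspaceT; exact: bform_sq_continuous.
move=> v /set_mem[/= Wv av] vmax.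
exists (bform H v v), v; split => //.
- by apply: contra_eq_neq Wv => ->; rewrite bform0l eq_sym oner_neq0.
- by rewrite Wv mulr1.
move=> u au; have [->|u0] := eqVneq u 0.
  by rewrite !bform0l mulr0.
have [k ku k2] := scale u u0.
have := vmax (k *: u); rewrite !bZl !bZr mulrA -expr2.
move=> H'; rewrite -(ler_pM2l k2) mulrCA ku mulr1; apply: H'; apply/mem_set.
by split => /=; rewrite ?bZl bZr ?au ?mulr0// mulrA -expr2.
Qed.

(** The form of the graph Laplacian with conductances S i j; the diagonal of S,
    whose sign is unknown in the application, cancels. *)
Lemma laplacian_form {R : realType} {N : nat} (S : 'M[R]_N) (a : 'I_N -> R) :
  S^T = S ->
  \sum_i \sum_j S i j * (a i - a j) ^+ 2 =
  2 * (\sum_i \sum_j S i j * a i ^+ 2 - \sum_i \sum_j S i j * a i * a j).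
Proof.
move=> ST.
have E : \sum_i \sum_j S i j * a j ^+ 2 = \sum_i \sum_j S i j * a i ^+ 2.
  rewrite exchange_big/=; apply: eq_bigr => i _; apply: eq_bigr => j _.
  by rewrite -[in LHS]ST mxE.
rewrite mulrBr mulr_natl mulr2n -{2}E -big_split/= mulr_sumr -sumrB.
apply: eq_bigr => i _; rewrite -big_split/= mulr_sumr -sumrB.
by apply: eq_bigr => j _; ring.
Qed.

(** In the coordinates a_i = v_i / x_i the difference of the two sides is half
    the Laplacian form with conductances x_i H_ij x_j.  It is non-negative, and
    when it vanishes irreducibility propagates a_i = a_j along chains, so that
    v is a multiple of x. *)
Lemma perron_frobenius_bform {R : realType} {N : nat} (H : 'M[R]_N)
    (x w v : 'rV[R]_N) (l : R) :
  H^T = H -> (forall i j, i != j -> 0 <= H i j) -> irreducible_mx H ->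
  (forall i, 0 < x ord0 i) -> x *m H = l *: (x *m diag_mx w) ->
  bform H v v <= l * bform (diag_mx w) v v /\
  (bform H v v = l * bform (diag_mx w) v v -> exists c, v = c *: x).
Proof.
move=> HT H0 irr x0 xH.
pose a i := v ord0 i / x ord0 i.
pose S := \matrix_(i, j) (x ord0 i * H i j * x ord0 j).
have ST : S^T = S.
  by apply/matrixP => i j; rewrite !mxE -[in LHS]HT mxE; ring.
have va i : v ord0 i = x ord0 i * a i.
  by rewrite /a mulrCA divff ?mulr1// gt_eqF.
have := laplacian_form S a ST.
have -> : \sum_i \sum_j S i j * a i * a j = bform H v v.
  rewrite exchange_big/=; apply: eq_bigr => i _; rewrite mxE mulr_suml.
  by apply: eq_bigr => j _; rewrite mxE !va; ring.
have -> : \sum_i \sum_j S i j * a i ^+ 2 = l * bform (diag_mx w) v v.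
  rewrite bform_diag mulr_sumr; apply: eq_bigr => i _.
  have /matrixP/(_ ord0 i) := xH; rewrite mul_mx_diag !mxE => E.
  rewrite !va (_ : _ * _ =
    l * (x ord0 i * w ord0 i) * (x ord0 i * a i ^+ 2)); last by ring.
  rewrite -E mulr_suml; apply: eq_bigr => j _.
  by rewrite !mxE -[in LHS]HT mxE; ring.
have T0 i j : 0 <= S i j * (a i - a j) ^+ 2.
  have [<-|ij] := eqVneq i j; first by rewrite subrr expr0n mulr0.
  by rewrite mulr_ge0 ?sqr_ge0// mxE !mulr_ge0 ?H0// ltW.
move=> E; split.
  rewrite -subr_ge0 -(pmulr_rge0 _ (ltr0n R 2)) -E.
  by apply: sumr_ge0 => i _; apply: sumr_ge0.
move=> Q; move: E; rewrite Q subrr mulr0 => /eqP.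
rewrite psumr_eq0 => [/allP E|i _]; last exact: sumr_ge0.
have step i j : (i != j) && (0 < H i j) -> a i = a j.
  move=> /andP[_ Hij].
  have := E i (mem_index_enum _); rewrite /= psumr_eq0// => /allP.
  move=> /(_ j (mem_index_enum _)); rewrite /= mulf_eq0 sqrf_eq0 subr_eq0 => /orP[|/eqP//].
  by rewrite mxE gt_eqF// !mulr_gt0.
have const i j : a i = a j.
  have [->//|/irr[s]] := eqVneq i j.
  elim: s i => [|k s IH] i /=; first by rewrite andbT => /step.
  by move=> /andP[/step -> /IH].
have [i _|e0] := pickP 'I_N; last first.
  by exists 0; apply/rowP => i; have := e0 i.
exists (a i); apply/rowP => j; rewrite mxE va mulrC; congr (_ * _).
exact: const.
Qed.

(** Let A = diag (1 / w) H, self-adjoint for the inner product with weights w.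
    The hypotheses say that l A <= A^2 as forms and that x is a positive
    eigenvector of eigenvalue l.  If the form of H were positive somewhere on
    the w-orthogonal complement of x, a maximizer y of the Rayleigh quotient
    there would be an eigenvector of A of eigenvalue M > 0.  Then l A <= A^2
    gives l <= M, Perron-Frobenius gives M <= l, and simplicity of l makes y a
    multiple of x, contradicting orthogonality.  So H is non-positive on the
    complement, and the inequality follows by splitting v along x. *)
Lemma reversed_cauchy_schwarz {R : realType} {N : nat} (H : 'M[R]_N)
    (x w : 'rV[R]_N) (l : R) :
  H^T = H -> (forall i j, i != j -> 0 <= H i j) -> irreducible_mx H ->
  (forall i, 0 < x ord0 i) -> (forall i, 0 < w ord0 i) -> 0 < l ->
  x *m H = l *: (x *m diag_mx w) ->
  (forall v : 'rV[R]_N,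
     l * bform H v v <= \sum_i (w ord0 i)^-1 * (v *m H) ord0 i ^+ 2) ->
  forall v, bform H v v * bform H x x <= bform H v x ^+ 2.
Proof.
move=> HT H0 irr x0 w0 l0 xH key v.
set W := diag_mx w.
have WT : W^T = W by rewrite tr_diag_mx.
have QxW u : bform H x u = l * bform W x u.
  by rewrite /bform xH mulr_sumr; apply: eq_bigr => i _; rewrite mxE mulrA.
have [Nz|xN] := eqVneq x 0.
  by rewrite [X in _ <= X ^+ 2](bformC H)// Nz bform0l mulr0 sqr_ge0.
have Wx : 0 < bform W x x by exact: bform_diag_gt0.
suff perp u : bform W x u = 0 -> bform H u u <= 0.
  (* v - c x is the component of v orthogonal to x. *)
  pose c := bform W x v / bform W x x.
  have cW : c * bform W x x = bform W x v by rewrite /c divfK// gt_eqF.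
  have := perp (v + (- c) *: x).
  rewrite !bformDr// !bformDl [bform H v x]bformC// !QxW.
  rewrite -cW mulNr subrr => /(_ erefl) le0.
  have le1 : bform H v v <= l * c ^+ 2 * bform W x x by lra.
  rewrite (_ : (l * _) ^+ 2 = l * c ^+ 2 * bform W x x * (l * bform W x x)).
    by rewrite ler_wpM2r// mulr_ge0// ltW.
  by ring.
move=> Wu; rewrite leNgt; apply/negP => Qu.
have u0 : u != 0 by apply: contraTneq Qu => ->; rewrite bform0l ltxx.
have [|M [y [y0 Wy QM Mmax]]] := rayleigh_max_perp H w x w0; first by exists u.
have Wyy : 0 < bform W y y by exact: bform_diag_gt0.
have M0 : 0 < M.
  have := lt_le_trans Qu (Mmax u Wu).
  by rewrite pmulr_lgt0// bform_diag_gt0.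
(* z = A y - M y is again orthogonal to x; maximality of the quotient at y
   along the line y + t z forces it to vanish. *)
pose z : 'rV[R]_N := \row_i ((w ord0 i)^-1 * (y *m H) ord0 i - M * y ord0 i).
have Wz s : bform W z s = bform H y s - M * bform W y s.
  rewrite !bform_diag /bform mulr_sumr -sumrB; apply: eq_bigr => i _.
  by rewrite [z _ _]mxE; field; rewrite gt_eqF.
have Wxz : bform W x z = 0.
  by rewrite bformC// Wz bformC// QxW [bform W y x]bformC// Wy !mulr0 subrr.
have z0 : z = 0.
  apply/eqP; apply: contraT => z0.
  have Wzz : 0 < bform W z z := bform_diag_gt0 w z w0 z0.
  have Qyz : bform H y z = M * bform W y z + bform W z z.
    by rewrite (Wz z); ring.
  pose A := M * bform W z z - bform H z z.
  have bound t : 2 * t * bform W z z <= t ^+ 2 * A.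
    have := Mmax (y + t *: z).
    rewrite !bformDr// !bformDl -/W Wy Wxz mulr0 addr0 => /(_ erefl).
    by rewrite [bform H z y]bformC// [bform W z y]bformC// QM Qyz /A; lra.
  have A1 : 0 < `|A| + 1 by rewrite ltr_wpDl.
  pose t := bform W z z / (`|A| + 1).
  have t0 : 0 < t by rewrite divr_gt0.
  have tA : t * A <= bform W z z.
    rewrite -[leRHS](divfK (lt0r_neq0 A1)) ler_pM2l//.
    by rewrite (le_trans (ler_norm A))// lerDl.
  have := bound t; rewrite (_ : 2 * t * _ = t * (2 * bform W z z)); last by ring.
  by rewrite expr2 -[t * t * A]mulrA ler_pM2l//; lra.
have yH i : (y *m H) ord0 i = M * (w ord0 i * y ord0 i).
  have zi : z ord0 i = 0 by rewrite z0 mxE.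
  rewrite [z _ _]mxE in zi.
  have -> : (y *m H) ord0 i = w ord0 i * ((w ord0 i)^-1 * (y *m H) ord0 i
      - M * y ord0 i) + M * (w ord0 i * y ord0 i).
    by field; rewrite gt_eqF.
  by rewrite zi mulr0 add0r.
have QW := perron_frobenius_bform H x w y l HT H0 irr x0 xH.
have lM : l <= M.
  have := key y; rewrite QM mulrA.
  have -> : \sum_i (w ord0 i)^-1 * (y *m H) ord0 i ^+ 2 = M * M * bform W y y.
    rewrite bform_diag mulr_sumr; apply: eq_bigr => i _; rewrite yH.
    by field; rewrite gt_eqF.
  by rewrite ler_pM2r// ler_pM2r.
have Ml : M <= l by have := QW.1; rewrite QM ler_pM2r.
have [|c yc] := QW.2; first by rewrite QM; congr (_ * _); apply/le_anti/andP.
have : c * bform W x x = 0.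
  by rewrite -Wy yc -[c *: x]add0r bformDr// [bform W x 0]bformC// bform0l add0r.
move/eqP; rewrite mulf_eq0 (gt_eqF Wx) orbF => /eqP c0.
by move: y0; rewrite yc c0 scale0r eqxx.
Qed.

(** * Functions with continuous partial derivatives *)

Lemma is_derive_partials {R : realType} {N : nat} (C : set 'rV[R]_N)
    (g : 'rV[R]_N -> R) (x v : 'rV[R]_N) :
  open C ->
  (forall i y, C y -> derivable g y (delta_mx ord0 i)) ->
  (forall i y, C y -> {for y, continuous (partial i g)}) -> C x ->
  is_derive x v g (\sum_i v ord0 i * partial i g x).
Proof.
move=> Copen dg cg Cx; rewrite {1}(row_sum_delta v).
elim: (index_enum _) => [|i r IH]; first by rewrite !big_nil; exact: is_derive0.
rewrite !big_cons addrC [X in is_derive _ _ _ X]addrC.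
apply: is_derive_addl => //; last exact: cg.
by apply: filterS (open_nbhs_nbhs (conj Copen Cx)) => y; exact: dg.
Qed.

Lemma is_derive_sum_ord {R : realType} {N : nat} (F dF : 'I_N -> R -> R) (t : R) :
  (forall i, is_derive t (1 : R) (F i) (dF i t)) ->
  is_derive t (1 : R) (fun s => \sum_i F i s) (\sum_i dF i t).
Proof.
move=> dFt; rewrite (_ : (fun s => _) = \sum_(i < N) F i).
  exact: is_derive_sum.
by apply/funext => s; rewrite fct_sumE.
Qed.

Lemma is_derive_unique {R : realType} (F G : R -> R) (t a b : R) :
  (\forall s \near t, F s = G s) -> is_derive t (1 : R) F a ->
  is_derive t (1 : R) G b -> a = b.
Proof.
by move=> FG Fa [_ <-]; have [_ <-] := near_eq_is_derive FG Fa.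
Qed.

Lemma near_line {R : realType} {N : nat} (C : set 'rV[R]_N) (x v : 'rV[R]_N) :
  open C -> C x -> \forall t \near (0 : R), C (x + t *: v).
Proof.
move=> Copen Cx.
have := near_parallelogram x v v C (open_nbhs_nbhs (conj Copen Cx)).
apply: filterS => t /(_ t 0); rewrite scale0r addr0 normr0; exact.
Qed.

(** * Homogeneous and log-concave functions *)

Lemma is_derive_powR_homogeneous {R : realType} (q k : R) :
  is_derive (1 : R) (1 : R) (fun t => t `^ q * k) (q * k).
Proof.
have d1 := @is_derive1_powR R q 1 ltr01.
rewrite (_ : (fun t => _) = ((@powR R)^~ q) * cst k)//.
apply: is_derive_eq; rewrite scaler0 add0r powR1 mulr1.
by rewrite [LHS]mulrC.
Qed.

(** Euler's identity, by differentiating t |-> g (t x) at t = 1. *)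
Lemma euler_homogeneous {R : realType} {V : normedModType R} (g : V -> R)
    (x : V) (q d : R) :
  (forall t : R, 0 < t -> g (t *: x) = t `^ q * g x) ->
  is_derive x x g d -> d = q * g x.
Proof.
move=> gh; rewrite -{1}[x]scale1r -[1 *: x]add0r => /is_derive_line dg.
apply: is_derive_unique dg (is_derive_powR_homogeneous q (g x)).
near=> t; rewrite add0r gh//; near: t; exact: lt_nbhsr.
Unshelve. all: by end_near. Qed.

Lemma partial_homogeneous {R : realType} {N : nat} (C : set 'rV[R]_N)
    (g : 'rV[R]_N -> R) (q : R) (i : 'I_N) :
  open C -> cone C ->
  (forall y, C y -> derivable g y (delta_mx ord0 i)) ->
  (forall (y : 'rV[R]_N) (t : R), C y -> 0 < t -> g (t *: y) = t `^ q * g y) ->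
  forall (y : 'rV[R]_N) (t : R), C y -> 0 < t ->
    partial i g (t *: y) = t `^ (q - 1) * partial i g y.
Proof.
move=> Copen Ccone dg gh y t Cy t0.
pose e : 'rV[R]_N := delta_mx ord0 i.
have D1 : is_derive (t *: y + 0 *: e) e g (partial i g (t *: y)).
  by rewrite scale0r addr0; apply/derivableP/dg/Ccone.
have D2 : is_derive (y + (0 / t) *: e) e g (partial i g y).
  by rewrite mul0r scale0r addr0; apply/derivableP/dg.
move: D1 => /is_derive_line D1.
have {D2} D2 : is_derive (0 : R) (1 : R) (fun s => t `^ q * g (y + (s / t) *: e))
    (t `^ (q - 1) * partial i g y).
  have dl : is_derive (0 : R) (1 : R) (fun s : R => s / t) t^-1.
    rewrite (_ : (fun s => _) = id * cst t^-1)//.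
    by apply: is_derive_eq; rewrite scaler0 add0r [LHS]mulr1.
  have := @is_derive1_comp _ (fun s => g (y + s *: e)) (fun s => s / t) 0 _ _
    (is_derive_line _ _ _ _ _ D2) dl => D3.
  rewrite (_ : (fun s => _) = t `^ q \*: (fun s => g (y + (s / t) *: e)))//.
  apply: is_derive_eq.
  have -> : t `^ (q - 1) = t `^ q / t.
    by rewrite powRB ?powRr1 ?(ltW t0)// (gt_eqF t0) implybT.
  by rewrite /GRing.scale/=; ring.
apply: is_derive_unique D1 D2.
have := near_line C y (t^-1 *: e) Copen Cy; apply: filterS => s Cs.
rewrite -gh//; last by rewrite -scalerA.
by congr g; rewrite scalerDr !scalerA mulrCA divff ?mulr1// gt_eqF.
Qed.

Lemma itv01_ex {R : realType} (h : R) : 0 <= h -> h <= 1 ->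
  exists t : {i01 R}, t%:num = h.
Proof. by move=> h0 h1; exists (Itv01 h0 h1). Qed.

(** The difference quotients of a concave function along the segment from x to
    y are bounded below by F y - F x, hence so is their limit. *)
Lemma concave_tangent {R : realType} {N : nat} (C : set 'rV[R]_N)
    (F : 'rV[R]_N -> R) (x y : 'rV[R]_N) (d : R) :
  concave_function C F -> C x -> C y ->
  is_derive (0 : R) (1 : R) (fun t => F (x + t *: (y - x))) d ->
  F y <= F x + d.
Proof.
move=> Fconc Cx Cy [dF dv].
have : (fun h : R => h^-1 *: (((fun t : R => F (x + t *: (y - x))) \o shift 0)
   (h *: 1) - F (x + 0 *: (y - x)))) @ 0^' --> d by rewrite -dv; exact: dF.
move=> /cvg_dnbhs_at_right cd.
rewrite -lerBlDl; apply: (cvgr_to_ge cd).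
near=> h.
have h0 : 0 < h by near: h; exact: nbhs_right_gt.
have h1 : h <= 1 by near: h; exact: nbhs_right_le.
have [t th] := itv01_ex h (ltW h0) h1.
have Fh : h * F y + (1 - h) * F x <= F (h *: y + (1 - h) *: x).
  by rewrite -th; exact: Fconc t y x (mem_set Cy) (mem_set Cx).
rewrite /= addr0 [h *: 1]mulr1 scale0r addr0 [_ *: _]mulrC ler_pdivlMr//.
have -> : x + h *: (y - x) = h *: y + (1 - h) *: x.
  by rewrite scalerBr scalerBl scale1r addrCA.
rewrite lerBrDr (le_trans _ Fh)// /GRing.scale/=; lra.
Unshelve. all: by end_near. Qed.

(** Log-concavity bounds g above by exp of its logarithmic tangent at x.  Along
    the ray of y the bound can be optimized: at s y, where s is chosen so that
    the derivative of g at x vanishes in the direction s y - x, it says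
    g (s y) <= g x, i.e. g y <= g x * s^-q.  In other words g^(1/q) lies
    below its linear tangent. *)
Lemma logconcave_homogeneous_bound {R : realType} {N : nat} (C : set 'rV[R]_N)
    (g : 'rV[R]_N -> R) (q : R) (x y dg : 'rV[R]_N) :
  cone C -> C x -> C y -> 0 < q -> (forall z, C z -> 0 < g z) ->
  (forall (z : 'rV[R]_N) (t : R), C z -> 0 < t -> g (t *: z) = t `^ q * g z) ->
  concave_function C (fun z => ln (g z)) ->
  (forall v : 'rV[R]_N, is_derive x v g (\sum_i v ord0 i * dg ord0 i)) ->
  0 < \sum_i y ord0 i * dg ord0 i ->
  g y <= g x * ((\sum_i y ord0 i * dg ord0 i) / (q * g x)) `^ q.
Proof.
move=> Ccone Cx Cy q0 gpos gh gconc gd.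
have gx := gpos x Cx.
have dgx : \sum_i x ord0 i * dg ord0 i = q * g x.
  by apply: euler_homogeneous (gd x) => t; exact: gh.
set d := \sum_i y ord0 i * dg ord0 i => d0.
pose s := q * g x / d.
have s0 : 0 < s by rewrite divr_gt0// mulr_gt0.
have sd : s * d = q * g x by rewrite /s divfK// gt_eqF.
have dir : \sum_i (s *: y - x) ord0 i * dg ord0 i = 0.
  transitivity (s * d - q * g x); last by rewrite sd subrr.
  rewrite -dgx mulr_sumr -sumrB; apply: eq_bigr => i _.
  by rewrite !mxE mulrBl mulrA.
have D : is_derive (0 : R) (1 : R) (fun t => ln (g (x + t *: (s *: y - x)))) 0.
  have dl : is_derive (g (x + 0 *: (s *: y - x))) (1 : R) (@ln R) (g x)^-1.
    by rewrite scale0r addr0; exact: is_derive1_ln.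
  have dgl : is_derive (x + 0 *: (s *: y - x)) (s *: y - x) g 0.
    by rewrite scale0r addr0 -dir; exact: gd.
  have := @is_derive1_comp _ (@ln R) (fun t => g (x + t *: (s *: y - x))) 0 _ _
    dl (is_derive_line _ _ _ _ _ dgl).
  by rewrite mulr0.
have := concave_tangent C (fun z => ln (g z)) x (s *: y) 0 gconc Cx
  (Ccone _ _ Cy s0) D.
rewrite addr0 ler_ln ?posrE ?gpos//; last exact: Ccone.
rewrite gh// => le.
have -> : d / (q * g x) = s^-1 by rewrite /s invf_div.
rewrite -powR_inv1 ?(ltW s0)// -powRrM mulN1r powRN.
by rewrite ler_pdivlMr ?powR_gt0// mulrC.
Qed.

(** * Second order comparisons on the line *)

Lemma is_derive_affine {R : realType} (a b t : R) :
  is_derive t (1 : R) (fun s => a + s * b) b.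
Proof.
exact: (@is_derive_line R R id a b t b (is_derive_id _ _)).
Qed.

Lemma is_derive_affine_powR {R : realType} (a b q t : R) : 0 < a + t * b ->
  is_derive t (1 : R) (fun s => (a + s * b) `^ q)
    (q * (a + t * b) `^ (q - 1) * b).
Proof.
move=> ab0.
have d1 := @is_derive1_powR R q _ ab0.
exact: (@is_derive1_comp _ ((@powR R)^~ q) (fun s => a + s * b) t _ _ d1
  (is_derive_affine a b t)).
Qed.

Lemma near_affine_gt0 {R : realType} {N : nat} (a b : 'I_N -> R) :
  (forall i, 0 < a i) -> \forall t \near (0 : R), forall i, 0 < a i + t * b i.
Proof.
move=> a0.
apply: (@filter_forall R 'I_N (fun i t => 0 < a i + t * b i) (nbhs (0 : R)) _).
move=> i; have ct : {for (0 : R), continuous (fun t : R => a i + t * b i)}.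
  have [d _] := is_derive_affine (a i) (b i) 0.
  by apply: differentiable_continuous; apply/derivable1_diffP.
have := @cvgr_gt _ _ _ _ _ _ ct 0.
by rewrite mul0r addr0; apply.
Qed.

Lemma is_derive_mul {R : realType} (F G : R -> R) (t a b : R) :
  is_derive t (1 : R) F a -> is_derive t (1 : R) G b ->
  is_derive t (1 : R) (fun s => F s * G s) (a * G t + F t * b).
Proof.
move=> Fa Gb; rewrite (_ : (fun s => _) = F * G)//.
by apply: is_derive_eq; rewrite /GRing.scale/=; ring.
Qed.

(** The right-hand side of the hypothesis minus (q + 1) phi is non-negative
    near 0 and vanishes at 0, so its second derivative at 0 is non-negative.
    That derivative is
      2 sum_i v_i h_i + (q - 1) / q sum_i x_i h_i^2 / g_i - (q + 1) sum_i v_i h_i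
    and division by (q - 1) / q > 0 yields the conclusion.  The exponents match
    the situation where phi is the restriction to a line of a function of
    degree q + 1 whose gradient is g and whose Hessian maps v to h. *)
Lemma second_order_comparison {R : realType} {N : nat} (x g h v : 'rV[R]_N)
    (q : R) (phi dphi : R -> R) :
  1 < q -> (forall i, 0 < g ord0 i) ->
  (\forall t \near (0 : R), (q + 1) * phi t <=
     \sum_i (x ord0 i + t * v ord0 i) * g ord0 i *
       (1 + t * (h ord0 i / (q * g ord0 i))) `^ q) ->
  (q + 1) * phi 0 = \sum_i x ord0 i * g ord0 i ->
  (\forall t \near (0 : R), is_derive t (1 : R) phi (dphi t)) ->
  is_derive (0 : R) (1 : R) dphi (\sum_i v ord0 i * h ord0 i) ->
  q * (\sum_i v ord0 i * h ord0 i) <= \sum_i x ord0 i / g ord0 i * h ord0 i ^+ 2.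
Proof.
move=> q1 g0 phile phi0 dphiP d2phi.
have q0 : 0 < q by apply: lt_trans q1.
pose c i := h ord0 i / (q * g ord0 i).
have base : \forall t \near (0 : R), forall i, 0 < 1 + t * c i.
  by apply: (near_affine_gt0 (fun=> 1)) => i; exact: ltr01.
pose A i t := x ord0 i * g ord0 i + t * (v ord0 i * g ord0 i).
pose P i r t := (1 + t * c i) `^ r.
pose T i t := A i t * P i q t.
pose T1 i t := v ord0 i * g ord0 i * P i q t + A i t * (q * P i (q - 1) t * c i).
pose T2 i := v ord0 i * g ord0 i * (q * c i) +
  (v ord0 i * g ord0 i * (q * c i) +
   x ord0 i * g ord0 i * (q * (q - 1) * c i ^+ 2)).
have P0 i r : P i r 0 = 1 by rewrite /P mul0r addr0 powR1.
have dP i r t : 0 < 1 + t * c i ->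
    is_derive t (1 : R) (P i r) (r * P i (r - 1) t * c i).
  exact: is_derive_affine_powR.
have dA i t : is_derive t (1 : R) (A i) (v ord0 i * g ord0 i).
  exact: is_derive_affine.
have dT i t : 0 < 1 + t * c i -> is_derive t (1 : R) (T i) (T1 i t).
  by move=> bt; apply: is_derive_mul => //; exact: dP.
have dT1 i : is_derive (0 : R) (1 : R) (T1 i) (T2 i).
  have b0 : 0 < 1 + 0 * c i by rewrite mul0r addr0 ltr01.
  have D1 := is_deriveZ (v ord0 i * g ord0 i) (dP i q 0 b0).
  have D2 := is_deriveZ (q * c i) (dP i (q - 1) 0 b0).
  have D3 := is_derive_mul _ _ _ _ _ (dA i 0) D2.
  have := is_deriveD D1 D3.
  rewrite (_ : _ + _ = T1 i).
    move=> D; apply: is_derive_eq D _.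
    by rewrite /GRing.scale/= /A !P0 /T2 /= [(q * c i)%:A]mulr1; ring.
  by apply/funext => t; rewrite /T1 [q * _ * c i]mulrAC.
pose F t := \sum_i T i t - (q + 1) * phi t.
pose dF t := \sum_i T1 i t - (q + 1) * dphi t.
have F00 : F 0 = 0.
  rewrite /F phi0 -sumrB big1// => i _.
  by rewrite /T P0 /A mul0r addr0 mulr1 subrr.
have F0 : \forall t \near (0 : R), F 0 <= F t.
  rewrite F00; apply: filterS phile => t; rewrite subr_ge0 => /le_trans; apply.
  rewrite le_eqVlt; apply/orP; left; apply/eqP; apply: eq_bigr => i _.
  by rewrite /T /A /P /c; congr (_ * _); ring.
have Fd : \forall t \near (0 : R), is_derive t (1 : R) F (dF t).
  apply: filterS2 base dphiP => t bt dphit.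
  have Ds := is_derive_sum_ord T T1 t (fun i => dT i t (bt i)).
  exact: (is_deriveB Ds (is_deriveZ (q + 1) dphit)).
have Fdd : is_derive (0 : R) (1 : R) dF
    (\sum_i T2 i - (q + 1) * \sum_i v ord0 i * h ord0 i).
  have Ds := is_derive_sum_ord T1 (fun i _ => T2 i) 0 dT1.
  exact: (is_deriveB Ds (is_deriveZ (q + 1) d2phi)).
have := second_derive_min F dF _ F0 Fd Fdd.
have -> : \sum_i T2 i = 2 * (\sum_i v ord0 i * h ord0 i) +
    (q - 1) / q * \sum_i x ord0 i / g ord0 i * h ord0 i ^+ 2.
  rewrite !mulr_sumr -big_split/=; apply: eq_bigr => i _.
  by rewrite /T2 /c; field; rewrite !gt_eqF.
set S := \sum_i _; set S' := \sum_i _ => le0.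
have le1 : (q - 1) / q * (q * S) <= (q - 1) / q * S'.
  by rewrite mulrA divfK ?gt_eqF//; lra.
by rewrite ler_pM2l// in le1; rewrite divr_gt0// subr_gt0.
Qed.

Lemma concave_on_segment {R : realType} (F dF d2F : R -> R) (s : {i01 R}) :
  (forall t : R, 0 <= t <= 1 -> is_derive t (1 : R) F (dF t)) ->
  (forall t : R, 0 <= t <= 1 -> is_derive t (1 : R) dF (d2F t)) ->
  (forall t : R, 0 <= t <= 1 -> d2F t <= 0) ->
  s%:num * F 0 + (1 - s%:num) * F 1 <= F (1 - s%:num).
Proof.
move=> dFP d2FP d2F0.
have oc (t : R) : t \in `]0, 1[ -> 0 <= t <= 1.
  by rewrite in_itv/= => /andP[t0 t1]; rewrite !ltW.
have D1 (t : R) : t \in `]0, 1[ -> is_derive t (1 : R) ('D_1 (- F)) (- d2F t).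
  move=> t01; apply: (@near_eq_is_derive _ _ _ (- dF)).
    apply: filterS (near_in_itvoo t01) => z /oc z01.
    by have dz := is_deriveN (dFP z z01); rewrite derive_val.
  by have dt := is_deriveN (d2FP t (oc _ t01)).
have cont (t : R) : 0 <= t <= 1 -> {for t, continuous (- F)}.
  move=> /dFP dt; apply: differentiable_continuous; apply/derivable1_diffP.
  by have [] := is_deriveN dt.
have cF0 : - F x @[x --> (0 : R)^'+] --> - F 0.
  by apply: cvg_at_right_filter; apply: cont; rewrite lexx ler01.
have cF1 : - F x @[x --> (1 : R)^'-] --> - F 1.
  by apply: cvg_at_left_filter; apply: cont; rewrite lexx ler01.
have := @second_derivative_convex R (- F) 0 1 _ cF1 cF0 _ _ s ler01.
move=> H; have {}H : - F (s%:num * 0 + (1 - s%:num) * 1) <=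
    s%:num * (- F 0) + (1 - s%:num) * (- F 1).
  apply: H => t t01.
  - have t01' : t \in `]0, 1[ by rewrite in_itv.
    by have [_ ->] := D1 t t01'; rewrite oppr_ge0 d2F0// oc.
  - by have [] := is_deriveN (dFP t (oc _ t01)).
  - by have [] := D1 t t01.
by move: H; rewrite mulr0 add0r mulr1; lra.
Qed.

(** * The Hessian of a homogeneous function *)

Lemma smooth_on_is_derive {R : realType} {N : nat} (C : set 'rV[R]_N)
    (f : 'rV[R]_N -> R) (s : seq 'I_N) (x v : 'rV[R]_N) :
  open C -> smooth_on C f -> C x ->
  is_derive x v (foldr (@partial R N) f s)
    (\sum_i v ord0 i * partial i (foldr (@partial R N) f s) x).
Proof.
move=> Copen fs Cx; apply: (is_derive_partials C) => // i y Cy.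
  exact: (fs s y Cy).2.
exact: (fs (i :: s) y Cy).1.
Qed.

Lemma hessian_sym {R : realType} {N : nat} (C : set 'rV[R]_N)
    (f : 'rV[R]_N -> R) (x : 'rV[R]_N) :
  open C -> smooth_on C f -> C x -> (hessian f x)^T = hessian f x.
Proof.
move=> Copen fs Cx; apply/matrixP => i j; rewrite !mxE.
apply: derive_comm.
- apply: filterS (open_nbhs_nbhs (conj Copen Cx)) => y Cy.
  split; [exact: (fs [::] y Cy).2|exact: (fs [::] y Cy).2|
          exact: (fs [:: i] y Cy).2|exact: (fs [:: j] y Cy).2].
- exact: (fs [:: j; i] x Cx).1.
- exact: (fs [:: i; j] x Cx).1.
Qed.

Lemma mul_hessianE {R : realType} {N : nat} (f : 'rV[R]_N -> R)
    (x v : 'rV[R]_N) (i : 'I_N) :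
  (v *m hessian f x) ord0 i = \sum_j v ord0 j * partial j (partial i f) x.
Proof. by rewrite mxE; apply: eq_bigr => j _; rewrite mxE. Qed.

Lemma bform_hessianE {R : realType} {N : nat} (f : 'rV[R]_N -> R)
    (x v : 'rV[R]_N) :
  bform (hessian f x) v v = \sum_i v ord0 i * (v *m hessian f x) ord0 i.
Proof. by apply: eq_bigr => i _; rewrite mulrC. Qed.

Lemma is_derive_line_smooth {R : realType} {N : nat} (C : set 'rV[R]_N)
    (f : 'rV[R]_N -> R) (x v : 'rV[R]_N) (t : R) :
  open C -> smooth_on C f -> C (x + t *: v) ->
  is_derive t (1 : R) (fun t => f (x + t *: v))
    (\sum_i v ord0 i * partial i f (x + t *: v)) /\
  is_derive t (1 : R) (fun t => \sum_i v ord0 i * partial i f (x + t *: v))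
    (bform (hessian f (x + t *: v)) v v).
Proof.
move=> Copen fs Cx; split.
  exact/is_derive_line/(smooth_on_is_derive C f [::]).
rewrite bform_hessianE.
apply: (is_derive_sum_ord (fun i t => v ord0 i * partial i f (x + t *: v))
  (fun i _ => v ord0 i * (v *m hessian f (x + t *: v)) ord0 i)) => i.
have D := smooth_on_is_derive C f [:: i] _ v Copen fs Cx.
rewrite mul_hessianE.
exact: (is_deriveZ (v ord0 i) (is_derive_line _ _ _ _ _ D)).
Qed.

Lemma smooth_euler {R : realType} {N : nat} (C : set 'rV[R]_N)
    (f : 'rV[R]_N -> R) (p : R) (x : 'rV[R]_N) :
  open C -> smooth_on C f ->
  (forall (y : 'rV[R]_N) (t : R), C y -> 0 < t -> f (t *: y) = t `^ p * f y) ->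
  C x -> \sum_i x ord0 i * partial i f x = p * f x.
Proof.
move=> Copen fs fh Cx.
by apply: euler_homogeneous (smooth_on_is_derive C f [::] x x Copen fs Cx) => t;
  exact: fh.
Qed.

(** Euler's identity for the partial derivatives, which have degree p - 1. *)
Lemma mul_hessian_homogeneous {R : realType} {N : nat} (C : set 'rV[R]_N)
    (f : 'rV[R]_N -> R) (p : R) (x : 'rV[R]_N) :
  open C -> cone C -> smooth_on C f ->
  (forall (y : 'rV[R]_N) (t : R), C y -> 0 < t -> f (t *: y) = t `^ p * f y) ->
  C x -> x *m hessian f x = (p - 1) *: \row_i partial i f x.
Proof.
move=> Copen Ccone fs fh Cx; apply/rowP => i.
rewrite [LHS]mul_hessianE !mxE.
apply: euler_homogeneous (smooth_on_is_derive C f [:: i] x x Copen fs Cx) => t.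
apply: (partial_homogeneous C) => // y Cy.
exact: (fs [::] y Cy).2.
Qed.

(** Let g = grad f and y = x + t v.  Euler's identity reads
    p f(y) = sum_i y_i g_i(y), and each g_i(y) is at most
    g_i(x) (1 + t (H v)_i / ((p - 1) g_i(x)))^(p - 1), because the derivative
    of g_i at x in the direction y equals (p - 1) g_i(x) + t (H v)_i.  The factors y_i are
    positive, so these bounds may be summed and compared to second order. *)
Lemma hessian_bochner {R : realType} {N : nat} (C : set 'rV[R]_N)
    (f : 'rV[R]_N -> R) (p : R) (x v : 'rV[R]_N) :
  C `<=` @pos_orthant R N -> open C -> cone C -> 2 < p -> smooth_on C f ->
  (forall (y : 'rV[R]_N) (t : R), C y -> 0 < t -> f (t *: y) = t `^ p * f y) ->
  (forall i y, C y -> 0 < partial i f y) ->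
  (forall i, concave_function C (fun y => ln (partial i f y))) -> C x ->
  (p - 1) * bform (hessian f x) v v <=
    \sum_i x ord0 i / partial i f x * (v *m hessian f x) ord0 i ^+ 2.
Proof.
move=> Corth Copen Ccone p2 fs fh fpos fconc Cx.
pose g : 'rV[R]_N := \row_i partial i f x.
have gE i : g ord0 i = partial i f x by rewrite mxE.
have g0 i : 0 < g ord0 i by rewrite gE fpos.
have q0 : 0 < p - 1 by lra.
have q1 : 1 < p - 1 by lra.
have pE : p = (p - 1) + 1 by rewrite subrK.
have xH := mul_hessian_homogeneous C f p x Copen Ccone fs fh Cx.
pose h := v *m hessian f x.
have nC := near_line C x v Copen Cx.
have lineH t i : ((x + t *: v) *m hessian f x) ord0 i =
    (p - 1) * g ord0 i + t * h ord0 i.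
  by rewrite mulmxDl xH -scalemxAl !mxE.
have base : \forall t \near (0 : R), forall i,
    0 < (p - 1) * g ord0 i + t * h ord0 i.
  by apply: near_affine_gt0 => i; rewrite mulr_gt0.
have phiP : \forall t \near (0 : R), is_derive t (1 : R)
    (fun t => f (x + t *: v)) (\sum_i v ord0 i * partial i f (x + t *: v)).
  apply: filterS nC => t Ct.
  exact: (is_derive_line_smooth C f x v t Copen fs Ct).1.
have dphiP : is_derive (0 : R) (1 : R)
    (fun t => \sum_i v ord0 i * partial i f (x + t *: v))
    (\sum_i v ord0 i * h ord0 i).
  have Ct : C (x + 0 *: v) by rewrite scale0r addr0.
  have := (is_derive_line_smooth C f x v 0 Copen fs Ct).2.
  by rewrite scale0r addr0 bform_hessianE.
have euler y : C y -> p * f y = \sum_i y ord0 i * partial i f y.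
  by move=> Cy; rewrite (smooth_euler C f p).
have phi0 : (p - 1 + 1) * f (x + 0 *: v) = \sum_i x ord0 i * g ord0 i.
  rewrite -pE scale0r addr0 euler//; apply: eq_bigr => i _.
  by rewrite gE.
have phile : \forall t \near (0 : R), (p - 1 + 1) * f (x + t *: v) <=
    \sum_i (x ord0 i + t * v ord0 i) * g ord0 i *
      (1 + t * (h ord0 i / ((p - 1) * g ord0 i))) `^ (p - 1).
  apply: filterS2 nC base => t Ct bt.
  rewrite -pE euler//; apply: ler_sum => i _.
  have -> : (x + t *: v) ord0 i = x ord0 i + t * v ord0 i by rewrite !mxE.
  rewrite -mulrA ler_wpM2l//.
    by have /ltW := Corth _ Ct i; rewrite !mxE.
  have dsum : \sum_j (x + t *: v) ord0 j *
      (\row_k partial k (partial i f) x) ord0 j =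
      (p - 1) * g ord0 i + t * h ord0 i.
    rewrite -lineH mul_hessianE; apply: eq_bigr => j _.
    by congr (_ * _); rewrite mxE.
  have := logconcave_homogeneous_bound C (partial i f) (p - 1) x (x + t *: v)
    (\row_k partial k (partial i f) x) Ccone Cx Ct q0 (fpos i) _ (fconc i).
  rewrite dsum gE => H.
  have -> : 1 + t * (h ord0 i / ((p - 1) * partial i f x)) =
      ((p - 1) * partial i f x + t * h ord0 i) / ((p - 1) * partial i f x).
    by field; rewrite !gt_eqF ?fpos.
  apply: H.
  - move=> y s Cy s0; apply: (partial_homogeneous C) => // z Cz.
    exact: (fs [::] z Cz).2.
  - move=> u; have := smooth_on_is_derive C f [:: i] x u Copen fs Cx.
    rewrite (eq_bigr (fun j => u ord0 j *
      (\row_k partial k (partial i f) x) ord0 j))// => j _.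
    by congr (_ * _); rewrite mxE.
  - by rewrite -gE.
have := second_order_comparison x g h v (p - 1) _ _ q1 g0 phile phi0 phiP dphiP.
rewrite -bform_hessianE => /le_trans; apply.
by apply: ler_sum => i _; rewrite gE.
Qed.

(** [reversed_cauchy_schwarz] with weights w_i = (grad f)_i / x_i, for which
    H x = (p - 1) diag (w) x, rewritten with Euler's identities for f and for
    its partial derivatives. *)
Lemma hessian_lorentzian {R : realType} {N : nat} (C : set 'rV[R]_N)
    (f : 'rV[R]_N -> R) (p : R) (x v : 'rV[R]_N) :
  C `<=` @pos_orthant R N -> open C -> cone C -> 2 < p -> smooth_on C f ->
  (forall (y : 'rV[R]_N) (t : R), C y -> 0 < t -> f (t *: y) = t `^ p * f y) ->
  (forall i y, C y -> 0 < partial i f y) ->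
  (forall i, concave_function C (fun y => ln (partial i f y))) ->
  (forall i j, i != j -> 0 <= hessian f x i j) ->
  irreducible_mx (hessian f x) -> C x ->
  p * f x * bform (hessian f x) v v <=
    (p - 1) * (\sum_i v ord0 i * partial i f x) ^+ 2.
Proof.
move=> Corth Copen Ccone p2 fs fh fpos fconc H0 irr Cx.
set H := hessian f x; set d := \sum_i _.
have q0 : 0 < p - 1 by lra.
have HT : H^T = H := hessian_sym C f x Copen fs Cx.
have xH := mul_hessian_homogeneous C f p x Copen Ccone fs fh Cx.
have xpos i : 0 < x ord0 i := Corth x Cx i.
pose w : 'rV[R]_N := \row_i (partial i f x / x ord0 i).
have w0 i : 0 < w ord0 i by rewrite mxE divr_gt0 ?fpos.
have xW : x *m H = (p - 1) *: (x *m diag_mx w).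
  rewrite xH; congr (_ *: _); apply/rowP => i.
  by rewrite mul_mx_diag !mxE mulrC divfK// gt_eqF.
have bx u : bform H u x = (p - 1) * \sum_i u ord0 i * partial i f x.
  rewrite bformC// /bform xH mulr_sumr; apply: eq_bigr => i _.
  by rewrite !mxE -mulrA [_ * u _ _]mulrC.
have key u : (p - 1) * bform H u u <= \sum_i (w ord0 i)^-1 * (u *m H) ord0 i ^+ 2.
  have := hessian_bochner C f p x u Corth Copen Ccone p2 fs fh fpos fconc Cx.
  move=> /le_trans; apply.
  by apply: ler_sum => i _; rewrite [w _ _]mxE invf_div.
have := reversed_cauchy_schwarz H x w (p - 1) HT H0 irr xpos w0 q0 xW key v.
rewrite !bx (smooth_euler C f p)// -/d => le0.
rewrite -(ler_pM2l q0).
have -> : (p - 1) * (p * f x * bform H v v) =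
    bform H v v * ((p - 1) * (p * f x)) by ring.
by rewrite (le_trans le0)// exprMn expr2 -mulrA lexx.
Qed.

(** * Concavity of the p-th root *)

(** The expression is the second derivative of F^(1/p); it factors as a positive
    multiple of p F F'' - (p - 1) F'^2. *)
Lemma second_derive_root_le0 {R : realType} (p F dF d2F : R) :
  0 < p -> 0 < F -> p * F * d2F <= (p - 1) * dF ^+ 2 ->
  p^-1 * ((p^-1 - 1) * F `^ (p^-1 - 1 - 1) * dF) * dF +
    p^-1 * F `^ (p^-1 - 1) * d2F <= 0.
Proof.
move=> p0 F0 H.
have -> : F `^ (p^-1 - 1) = F `^ (p^-1 - 1 - 1) * F.
  by rewrite -[X in _ * X]powRr1 ?(ltW F0)// -powRD ?subrK// (gt_eqF F0) implybT.
have P0 : 0 < F `^ (p^-1 - 1 - 1) by rewrite powR_gt0.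
have -> : p^-1 * ((p^-1 - 1) * F `^ (p^-1 - 1 - 1) * dF) * dF +
    p^-1 * (F `^ (p^-1 - 1 - 1) * F) * d2F =
   p^-1 * p^-1 * F `^ (p^-1 - 1 - 1) * (p * F * d2F - (p - 1) * dF ^+ 2).
  by field; rewrite gt_eqF.
by rewrite mulr_ge0_le0 ?subr_le0// !mulr_ge0 ?invr_ge0 ?ltW.
Qed.

Theorem proposition3 (R : realType) (N : nat) (N_ge1 : (1 <= N)%N)
    (C : set 'rV[R]_N)
    (C_orthant : C `<=` @pos_orthant R N)
    (C_open : open C) (C_convex : convex_set C) (C_cone : cone C)
    (p : R) (p_gt2 : 2 < p)
    (f : 'rV[R]_N -> R)
    (f_pos : forall x, C x -> 0 < f x)
    (f_smooth : smooth_on C f)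
    (f_homogeneous : forall (x : 'rV[R]_N) (t : R),
      C x -> 0 < t -> f (t *: x) = t `^ p * f x)
    (partial_pos : forall i x, C x -> 0 < partial i f x)
    (partial_logconcave : forall i : 'I_N,
      concave_function C (fun x => ln (partial i f x)))
    (hessian_offdiag_ge0 : forall i j : 'I_N, i != j ->
      forall x, C x -> 0 <= hessian f x i j)
    (hessian_irreducible : forall x, C x -> irreducible_mx (hessian f x)) :
  concave_function C (fun x => f x `^ p^-1).
Proof.
move=> s x y xC yC.
have p0 : 0 < p by lra.
pose v : 'rV[R]_N := y - x.
have segE (t : R) : x + t *: v = (1 - t) *: x + t *: y.
  by rewrite /v scalerBr scalerBl scale1r addrA addrAC.
have seg (t : R) : 0 <= t <= 1 -> C (x + t *: v).
  move=> /andP[t0 t1]; have t0' : 0 <= 1 - t by rewrite subr_ge0.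
  have t1' : 1 - t <= 1 by rewrite gerBl.
  have [r rE] := itv01_ex (1 - t) t0' t1'.
  have := C_convex x y r xC yC; rewrite inE segE.
  by rewrite (_ : conv r x y = r%:num *: x + (1 - r%:num) *: y)// rE subKr.
pose F t := f (x + t *: v).
pose dF t := \sum_i v ord0 i * partial i f (x + t *: v).
pose d2F t := bform (hessian f (x + t *: v)) v v.
pose G t := F t `^ p^-1.
pose dG t := p^-1 * F t `^ (p^-1 - 1) * dF t.
pose d2G t := p^-1 * ((p^-1 - 1) * F t `^ (p^-1 - 1 - 1) * dF t) * dF t +
    p^-1 * F t `^ (p^-1 - 1) * d2F t.
have F0 (t : R) : 0 <= t <= 1 -> 0 < F t by move=> /seg; exact: f_pos.
have D (t : R) : 0 <= t <= 1 -> is_derive t (1 : R) F (dF t) /\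
    is_derive t (1 : R) dF (d2F t).
  by move=> /seg; exact: is_derive_line_smooth.
have DP (r t : R) : 0 <= t <= 1 ->
    is_derive t (1 : R) (fun t => F t `^ r) (r * F t `^ (r - 1) * dF t).
  move=> t01; exact: (@is_derive1_comp _ ((@powR R)^~ r) F t _ _
    (is_derive1_powR r (F0 t t01)) (D t t01).1).
(* The convex combination s x + (1 - s) y has parameter 1 - s on the segment. *)
have HG : s%:num * G 0 + (1 - s%:num) * G 1 <= G (1 - s%:num).
  apply: (concave_on_segment G dG d2G s (DP p^-1)) => t t01.
  - have DG := is_deriveZ p^-1 (DP (p^-1 - 1) t t01).
    exact: (is_derive_mul _ _ _ _ _ DG (D t t01).2).
  - apply: second_derive_root_le0 => //; first exact: F0.
    apply: (hessian_lorentzian C) => //.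
    + by move=> i j ij; apply: hessian_offdiag_ge0 => //; exact: seg.
    + exact: hessian_irreducible (seg t t01).
    + exact: seg.
move: HG; rewrite /G /F (segE (1 - s%:num)) subKr scale0r addr0 scale1r.
rewrite (_ : x + v = y); last by rewrite /v addrC subrK.
exact.
Qed.
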